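(* Let $\delta>0$, let $|\psi\rangle\in\mathbb C^d$ be a unit vector and $\rho=|\psi\rangle\langle\psi|$. Let $|\phi_0\rangle=|0\rangle\otimes\dots\otimes|0\rangle\in(\mathbb C^2)^{\otimes d}$ and $\sigma=|\phi_0\rangle\langle\phi_0|$. Then there exist a unitary $\tilde U_\delta$ on $\mathbb C^d\otimes(\mathbb C^2)^{\otimes d}$, comprised of qubit rotations $R_\delta$ and qudit-controlled NOT gates $U_1,\dots,U_d$, and a basis measurement $\tilde M_{\tilde B}=(\mathbb 1\otimes|\omega\rangle\langle\omega|)_{\omega\in\{0,1\}^d}$ acting on the second system $(\mathbb C^2)^{\otimes d}$ alone, such that for $\rho_{\delta,\tilde U}=\tilde U_\delta(\rho\otimes\sigma)\tilde U_\delta^*$ and all $\omega\in\{0,1\}^d$, $$\mathbb P_{\rho_{\delta,\tilde U}}\big(R^{\tilde M_{\tilde B}}=\omega\big)=\mathbb P_\rho\big(R^{M_\delta}=\omega\big)\qquad\text{and}\qquad \operatorname{Tr}_2\big[(\rho_{\delta,\tilde U})_{\tilde M_{\tilde B}\to\omega}\big]=\rho_{M_\delta\to\omega},$$ where $M_\delta=(M_{\delta,\omega})_{\omega\in\{0,1\}^d}$ is the measurement on $\mathbb C^d$ given by $$M_{\delta,\omega}=\Big(\frac{e^{\delta/2}}{e^{\delta/2}+1}\Big)^{d/2}\sum_{k=1}^de^{-\frac\delta4\|\omega-e_k\|_1}|k\rangle\langle k|,$$ and $\operatorname{Tr}_2$ is the partial trace over the second system.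
   Context: $(|k\rangle)_{k=1}^d$ is the computational orthonormal basis of $\mathbb C^d$, $(|0\rangle,|1\rangle)$ that of $\mathbb C^2$; $e_k\in\{0,1\}^d$ is the $k$-th standard basis vector; $|\omega\rangle=|\omega_1\rangle\otimes\dots\otimes|\omega_d\rangle$. For a measurement $M=(M_\omega)_\omega$ with $\sum_\omega M_\omega^*M_\omega=\mathbb 1$, applied to a state $\rho$, $\mathbb P_\rho(R^M=\omega)=\operatorname{Tr}[\rho M_\omega^*M_\omega]$ is the outcome law and $\rho_{M\to\omega}=M_\omega\rho M_\omega^*/\mathbb P_\rho(R^M=\omega)$ the post-measurement state. A qubit rotation $R_\delta$ is a unitary on $\mathbb C^2$, here one depending only on $\delta$ and applied to each of the $d$ ancillary qubits. The qudit-controlled NOT gate $U_k$ acts on the qudit $\mathbb C^d$ and the $k$-th qubit by $|k\rangle\otimes|x\rangle\mapsto|k\rangle\otimes|1-x\rangle$ and $|l\rangle\otimes|x\rangle\mapsto|l\rangle\otimes|x\rangle$ for $l\ne k$, $x\in\{0,1\}$ (identity on the other qubits). *)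

(* Defs.v *)
From mathcomp Require Import all_boot all_order all_algebra.
From mathcomp Require Import ring reals sequences exp.
From mathcomp Require Export mxtens complex.

Set Implicit Arguments.
Unset Strict Implicit.
Unset Printing Implicit Defensive.

Import Order.TTheory GRing.Theory Num.Theory.

Local Open Scope ring_scope.
Local Open Scope sesquilinear_scope.
Local Open Scope complex_scope.

Notation "A *t B" := (tensmx A B)
  (at level 40, left associativity, format "A  *t  B") : ring_scope.

(* {0,1}^d; its elements label both the computational basis of (C^2)^{(x) d}
   and the measurement outcomes.  Since matrices are indexed by ordinals,
   (C^2)^{(x) d} is 'cV_#|bits d|, with coordinates reindexed by enum_rank. *)
Notation bits d := {ffun 'I_d -> 'I_2}.

Definition std_bits (d : nat) (k : 'I_d) : bits d :=
  [ffun j => if j == k then 1 else 0].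

Definition flip_bit (d : nat) (k : 'I_d) (x : bits d) : bits d :=
  [ffun j => if j == k then rev_ord (x j) else x j].

Definition l1_dist (K : numDomainType) (d : nat) (x y : bits d) : K :=
  \sum_(j < d) `|(x j : nat)%:R - (y j : nat)%:R|.

Section Quantum.
Variable C : numClosedFieldType.

Definition ket (n : nat) (k : 'I_n) : 'cV[C]_n := delta_mx k 0.

Definition unit_vector (n : nat) (v : 'cV[C]_n) : Prop :=
  v^t* *m v = 1%:M.

Definition pure_state (n : nat) (v : 'cV[C]_n) : 'M[C]_n := v *m v^t*.

(* The factors of (C^2)^{(x) d} are combined in one step: the entries of a
   d-fold Kronecker product are the products of the entries of its factors. *)
Definition tens_vec (d : nat) (v : 'I_d -> 'cV[C]_2) : 'cV[C]_#|bits d| :=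
  \col_x \prod_(j < d) v j ((enum_val x : bits d) j) 0.

Definition tens_op (d : nat) (A : 'I_d -> 'M[C]_2) : 'M[C]_#|bits d| :=
  \matrix_(x, y)
    \prod_(j < d) A j ((enum_val x : bits d) j) ((enum_val y : bits d) j).

Definition bits_ket (d : nat) (w : bits d) : 'cV[C]_#|bits d| :=
  tens_vec (fun j => ket (w j)).

Definition ptrace2 (m n : nat) (A : 'M[C]_(m * n)) : 'M[C]_m :=
  \matrix_(i, j) \sum_(k < n) A (mxtens_index (i, k)) (mxtens_index (j, k)).

Record measurement (O : finType) (n : nat) := Measurement {
  meas_op :> O -> 'M[C]_n;
  _ : \sum_(o : O) (meas_op o)^t* *m meas_op o = 1%:M }.

Definition outcome_prob (O : finType) (n : nat) (M : measurement O n)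
    (rho : 'M[C]_n) (o : O) : C :=
  \tr (rho *m ((M o)^t* *m M o)).

(* Meaningful when the outcome has nonzero probability (0^-1 = 0). *)
Definition post_state (O : finType) (n : nat) (M : measurement O n)
    (rho : 'M[C]_n) (o : O) : 'M[C]_n :=
  (outcome_prob M rho o)^-1 *: (M o *m rho *m (M o)^t*).

Definition rot_gate (d : nat) (Rot : 'M[C]_2) (j : 'I_d) :
    'M[C]_(d * #|bits d|) :=
  1%:M *t tens_op (fun i => if i == j then Rot else 1%:M).

(* The sum of |image><basis vector| over the basis |l> (x) |x>. *)
Definition cnot_gate (d : nat) (k : 'I_d) : 'M[C]_(d * #|bits d|) :=
  \sum_(l < d) \sum_(x : bits d)
    (ket l *t bits_ket (if l == k then flip_bit k x else x))
      *m (ket l *t bits_ket x)^t*.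

Definition gate_op (d : nat) (Rot : 'M[C]_2) (g : 'I_d + 'I_d) :
    'M[C]_(d * #|bits d|) :=
  match g with
  | inl j => rot_gate Rot j
  | inr k => cnot_gate k
  end.

(* U is the product, in some order, of the rotations Rot on each of the d
   qubits and of the controlled NOT gates U_1, ..., U_d, each taken once. *)
Definition comprised_of_gates (d : nat) (Rot : 'M[C]_2)
    (U : 'M[C]_(d * #|bits d|)) : Prop :=
  exists2 w : seq ('I_d + 'I_d),
    perm_eq w (enum {: 'I_d + 'I_d}) & U = \prod_(g <- w) gate_op Rot g.

End Quantum.

Section DeltaMeasurement.
Variable R : realType.

Definition delta_op (delta : R) (d : nat) (w : bits d) : 'M[R[i]]_d :=
  ((expR (delta / 2) / (expR (delta / 2) + 1)) `^ (d%:R / 2))%:C *: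
    \sum_(k < d)
      (expR (- (delta / 4) * l1_dist R w (std_bits k)))%:C *:
        (ket _ k *m (ket _ k)^t*).

Lemma delta_op_complete (delta : R) (d : nat) :
  \sum_(w : bits d) (delta_op delta w)^t* *m delta_op delta w = 1%:M.
Proof.
set p := expR (delta / 2) / (expR (delta / 2) + 1).
have p_gt0 : 0 < p by rewrite divr_gt0 ?addr_gt0 ?expR_gt0.
pose f (w : bits d) k := p `^ (d%:R / 2) *
  expR (- (delta / 4) * l1_dist R w (std_bits k)).
have opE w : delta_op delta w = diag_mx (\row_k (f w k)%:C).
  apply/matrixP => i j; rewrite /delta_op !mxE summxE.
  rewrite (bigD1 i) //= big1 ?addr0 => [|k ki]; last first.
    by rewrite !mxE big_ord1 !mxE eq_sym (negbTE ki) mul0r mulr0.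
  rewrite !mxE big_ord1 !mxE !eqxx mul1r andbT conjC_nat.
  rewrite eq_sym; case: (i == j) => /=; last by rewrite !mulr0 mulr0n.
  by rewrite mulr1 mulr1n /f rmorphM.
have conjCR (x : R) : Num.conj (x%:C : R[i]) = x%:C.
  by apply/conj_Creal; rewrite complex_real.
have adjE w : (delta_op delta w)^t* = diag_mx (\row_k (f w k)%:C).
  rewrite opE tr_diag_mx map_diag_mx; congr diag_mx.
  by apply/rowP => k; rewrite !mxE; exact: conjCR.
have sqE w k : f w k * f w k = \prod_(j < d)
    (p * expR (- (delta / 2) * `|(w j : nat)%:R - (std_bits k j : nat)%:R|)).
  rewrite big_split /= prodr_const card_ord -expR_sum -mulr_sumr.
  rewrite /f mulrACA -powRD ?(gt_eqF p_gt0) ?implybT //.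
  rewrite -[_ / 2 + _ / 2]splitr powR_mulrn ?ltW // -expRD -mulrDl.
  by congr (_ * expR (_ * _)); field.
apply/matrixP => i j; rewrite summxE.
under eq_bigr do rewrite adjE opE mulmx_diag !mxE -rmorphM /=.
rewrite mxE; case: (i == j); last by rewrite big1.
under eq_bigr do rewrite mulr1n sqE.
rewrite -rmorph_sum /= -[RHS](rmorph1 (real_complex R)); congr (_%:C).
pose g (j : 'I_d) (b : 'I_2) :=
  p * expR (- (delta / 2) * `|(b : nat)%:R - (std_bits i j : nat)%:R|).
rewrite -(bigA_distr_bigA g) big1 // => k _.
rewrite /g -mulr_sumr 2!big_ord_recl big_ord0 addr0 /std_bits ffunE.
have e0 : expR (delta / 2) + 1 != 0 by rewrite gt_eqF ?addr_gt0 ?expR_gt0.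
have e1 : expR (delta / 2) != 0 by rewrite gt_eqF ?expR_gt0.
by case: (k == i) => /=;
  rewrite ?subrr ?subr0 ?sub0r ?normrN ?normr0 ?normr1 ?mulr0 ?mulr1 ?expR0
    expRN /p; field; rewrite e0 e1.
Qed.

(* M_delta; its completeness holds for every real delta. *)
Definition delta_measurement (delta : R) (d : nat) :
    measurement R[i] (bits d) d :=
  Measurement (@delta_op_complete delta d).

End DeltaMeasurement.

(* Main.v *)
Require Import Defs.
From mathcomp Require Import all_boot all_order all_algebra.
From mathcomp Require Import reals.
From mathcomp Require Import mxtens complex.
From mathcomp Require Import ring sequences exp.

Set Implicit Arguments.
Unset Strict Implicit.
Unset Printing Implicit Defensive.

Local Open Scope ring_scope.
Local Open Scope sesquilinear_scope.
Local Open Scope complex_scope.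

Import Order.TTheory GRing.Theory Num.Theory.

(** Write p = e^(delta/2) / (e^(delta/2) + 1).  Then
    1 - p = 1 / (e^(delta/2) + 1) = p e^(-delta/2), so there is a real rotation
    sending |0> to sqrt p (|0> + e^(-delta/4) |1>).  The amplitude of an
    outcome bit is thus sqrt p e^(-(delta/4) |bit - 0|).  Rotate every ancilla
    in this way, and then let the qudit state |l> flip the l-th ancilla: the
    amplitude of a bit w_j becomes sqrt p e^(-(delta/4) |w_j - (e_l)_j|), and
    the product over j of these amplitudes is the diagonal entry of
    M_(delta, w) at |l>.  By linearity, the circuit maps |psi> (x) |0...0> to
    the sum over w of (M_(delta, w) |psi>) (x) |w>.  Projecting the ancillas on
    |w> leaves the product vector (M_(delta, w) |psi>) (x) |w>, whose squared
    norm is the required probability and whose reduced state is the required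
    one (ancilla_readout).

    All gates are block diagonal in the qudit basis, with product operators as
    blocks: each is a sum over l of |l><l| (x) (A_(l,1) (x) ... (x) A_(l,d))
    (ctrl_op, gate_opE).  Such operators multiply factor by factor (ctrl_opM),
    so unitarity, the product of the 2d gates (prod_gates) and the action of
    the circuit (ctrl_op_readout) all reduce to computations with 2 x 2
    matrices. *)

(** * Adjoints, Kronecker products and partial traces *)

Lemma adjmxM (C : numClosedFieldType) m n p
    (A : 'M[C]_(m, n)) (B : 'M[C]_(n, p)) :
  (A *m B)^t* = B^t* *m A^t*.
Proof. by rewrite trmx_mul map_mxM. Qed.

Lemma adjmx_tens (C : numClosedFieldType) m n p q
    (A : 'M[C]_(m, n)) (B : 'M[C]_(p, q)) :
  (A *t B)^t* = A^t* *t B^t*.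
Proof. by rewrite trmx_tens map_mxT. Qed.

Lemma tensmx_suml (R : pzRingType) (I : Type) (r : seq I) (P : pred I) m n p q
    (A : I -> 'M[R]_(m, n)) (B : 'M[R]_(p, q)) :
  (\sum_(i <- r | P i) A i) *t B = \sum_(i <- r | P i) (A i *t B).
Proof.
by apply/matrixP => i j; rewrite !(mxE, summxE) mulr_suml;
  apply: eq_bigr => k _; rewrite !mxE.
Qed.

Lemma tensmx_sumr (R : pzRingType) (I : Type) (r : seq I) (P : pred I) m n p q
    (A : 'M[R]_(m, n)) (B : I -> 'M[R]_(p, q)) :
  A *t (\sum_(i <- r | P i) B i) = \sum_(i <- r | P i) (A *t B i).
Proof.
by apply/matrixP => i j; rewrite !(mxE, summxE) mulr_sumr;
  apply: eq_bigr => k _; rewrite !mxE.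
Qed.

Lemma tensmxZl (R : pzRingType) m n p q (a : R)
    (A : 'M[R]_(m, n)) (B : 'M[R]_(p, q)) :
  (a *: A) *t B = a *: (A *t B).
Proof. by apply/matrixP => i j; rewrite !mxE mulrA. Qed.

Lemma tensmxZr (R : comPzRingType) m n p q (a : R)
    (A : 'M[R]_(m, n)) (B : 'M[R]_(p, q)) :
  A *t (a *: B) = a *: (A *t B).
Proof. by apply/matrixP => i j; rewrite !mxE mulrCA. Qed.

Lemma tensmx11 (R : pzRingType) m n :
  (1%:M : 'M[R]_m) *t (1%:M : 'M[R]_n) = 1%:M.
Proof.
apply/matrixP => i j.
case: (mxtens_indexP i) => i1 i2; case: (mxtens_indexP j) => j1 j2.
by rewrite tensmxE !mxE (can_eq (@mxtens_indexK _ _)) xpair_eqE -natrM mulnb.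
Qed.

Lemma ptrace2_tens (C : numClosedFieldType) m n (A : 'M[C]_m) (B : 'M[C]_n) :
  ptrace2 (A *t B) = \tr B *: A.
Proof.
apply/matrixP => i j; rewrite !mxE mulr_suml; apply: eq_bigr => k _.
by rewrite tensmxE mulrC.
Qed.

Lemma mxtrace_ptrace2 (C : numClosedFieldType) m n (A : 'M[C]_(m * n)) :
  \tr (ptrace2 A) = \tr A.
Proof.
rewrite /mxtrace; under eq_bigr do rewrite mxE.
rewrite pair_big /= [RHS](reindex (@mxtens_index m n)) /=.
  by apply: eq_bigr => -[].
exists (@mxtens_unindex m n) => i _; first exact: mxtens_indexK.
exact: mxtens_unindexK.
Qed.

Lemma ptrace2Z (C : numClosedFieldType) m n (a : C) (A : 'M[C]_(m * n)) :
  ptrace2 (a *: A) = a *: ptrace2 A.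
Proof.
apply/matrixP => i j; rewrite !mxE mulr_sumr.
by apply: eq_bigr => k _; rewrite mxE.
Qed.

Lemma pure_stateM (C : numClosedFieldType) m n
    (A : 'M[C]_(m, n)) (v : 'cV[C]_n) :
  pure_state (A *m v) = A *m pure_state v *m A^t*.
Proof. by rewrite /pure_state adjmxM !mulmxA. Qed.

Lemma pure_state_tens (C : numClosedFieldType) m n
    (u : 'cV[C]_m) (v : 'cV[C]_n) :
  pure_state (u *t v) = pure_state u *t pure_state v.
Proof. by rewrite /pure_state -tensmx_mul -adjmx_tens. Qed.

(** The outcome probability is the normalization of the post-measurement
    state, so it can be read off from that state's partial trace. *)
Lemma outcome_prob_tr (C : numClosedFieldType) (O : finType) n
    (M : measurement C O n) (rho : 'M[C]_n) (o : O) :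
  outcome_prob M rho o = \tr (M o *m rho *m (M o)^t*).
Proof. by rewrite /outcome_prob mulmxA mxtrace_mulC mulmxA. Qed.

(** * Computational bases *)

Lemma pure_ketE (C : numClosedFieldType) n (k : 'I_n) :
  pure_state (ket C k) = delta_mx k k.
Proof. by rewrite /pure_state /ket trmx_delta map_delta_mx mul_delta_mx. Qed.

Lemma pure_ket_mul (C : numClosedFieldType) n (k l : 'I_n) :
  pure_state (ket C k) *m pure_state (ket C l) =
  pure_state (ket C k) *+ (k == l).
Proof. by rewrite !pure_ketE mul_delta_mx_cond; case: eqP => // ->. Qed.

Lemma sum_pure_ket (C : numClosedFieldType) n :
  \sum_(k < n) pure_state (ket C k) = 1%:M.
Proof.
by rewrite mx1_sum_delta; apply: eq_bigr => k _; rewrite pure_ketE.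
Qed.

Lemma pure_ket_adj (C : numClosedFieldType) n (k : 'I_n) :
  (pure_state (ket C k))^t* = pure_state (ket C k).
Proof. by rewrite pure_ketE trmx_delta map_delta_mx. Qed.

(** * Product operators on the ancillas *)

Lemma sum_enum_bits (V : nmodType) d (F : bits d -> V) :
  \sum_(i < #|bits d|) F (enum_val i) = \sum_(w : bits d) F w.
Proof. by rewrite -big_enum_val. Qed.

(** Distributivity of a product of sums over bits: a sum over bit strings of
    products over the qubits is a product over the qubits of sums over bits. *)
Lemma tens_opM (C : numClosedFieldType) d (A B : 'I_d -> 'M[C]_2) :
  tens_op A *m tens_op B = tens_op (fun j => A j *m B j).
Proof.
apply/matrixP => x y; rewrite !mxE.
under [RHS]eq_bigr do rewrite mxE.
rewrite bigA_distr_bigA /= -sum_enum_bits; apply: eq_bigr => z _.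
by rewrite !mxE -big_split.
Qed.

Lemma tens_op_vec (C : numClosedFieldType) d (A : 'I_d -> 'M[C]_2)
    (v : 'I_d -> 'cV[C]_2) :
  tens_op A *m tens_vec v = tens_vec (fun j => A j *m v j).
Proof.
apply/matrixP => x y; rewrite !mxE.
under [RHS]eq_bigr do rewrite mxE.
rewrite bigA_distr_bigA /= -sum_enum_bits; apply: eq_bigr => z _.
by rewrite !mxE -big_split.
Qed.

Lemma bits_ketE (C : numClosedFieldType) d (w : bits d) :
  bits_ket C w = ket C (enum_rank w).
Proof.
apply/matrixP => x y; rewrite !mxE [y]ord1 eqxx andbT.
under eq_bigr do rewrite mxE eqxx andbT.
have -> : (x == enum_rank w) = (enum_val x == w :> bits d).
  by rewrite (can2_eq enum_valK enum_rankK).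
have [<-|/eqP ne] := (enum_val x : bits d) =P w.
  by rewrite big1 // => j _; rewrite eqxx.
have /existsP[j nej] : [exists j, (enum_val x : bits d) j != w j].
  rewrite -negb_forall; apply: contra ne => /forallP e.
  by apply/eqP/ffunP => j; exact/eqP.
by rewrite (bigD1 j) //= (negbTE nej) mul0r.
Qed.

Lemma tens_op1 (C : numClosedFieldType) d :
  tens_op (fun _ : 'I_d => 1%:M : 'M[C]_2) = 1%:M.
Proof.
apply/row_matrixP => i; apply/rowP => j.
transitivity (bits_ket C (enum_val j) i 0).
  by rewrite !mxE; apply: eq_bigr => k _; rewrite !mxE andbT.
by rewrite bits_ketE enum_valK !mxE andbT.
Qed.

Lemma tens_op_adj (C : numClosedFieldType) d (A : 'I_d -> 'M[C]_2) :
  (tens_op A)^t* = tens_op (fun j => (A j)^t*).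
Proof.
apply/matrixP => x y; rewrite !mxE rmorph_prod.
by apply: eq_bigr => j _; rewrite !mxE.
Qed.

Lemma eq_tens_op (C : numClosedFieldType) d (A B : 'I_d -> 'M[C]_2) :
  A =1 B -> tens_op A = tens_op B.
Proof.
by move=> e; apply/matrixP => x y; rewrite !mxE; apply: eq_bigr => j _;
  rewrite e.
Qed.

(** * Qudit-controlled product operators *)

(** Every gate has this form.  Since the form is stable under products, it
    reduces operators on the whole space to families of 2 x 2 matrices. *)
Definition ctrl_op (C : numClosedFieldType) d (A : 'I_d -> 'I_d -> 'M[C]_2) :
    'M[C]_(d * #|bits d|) :=
  \sum_(l < d) pure_state (ket C l) *t tens_op (A l).

Lemma eq_ctrl_op (C : numClosedFieldType) d (A B : 'I_d -> 'I_d -> 'M[C]_2) :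
  A =2 B -> ctrl_op A = ctrl_op B.
Proof. by move=> e; apply: eq_bigr => l _; rewrite (eq_tens_op (e l)). Qed.

(** The projections |l><l| are orthogonal, so only equal qudit values
    interact. *)
Lemma ctrl_opM (C : numClosedFieldType) d (A B : 'I_d -> 'I_d -> 'M[C]_2) :
  ctrl_op A *m ctrl_op B = ctrl_op (fun l j => A l j *m B l j).
Proof.
rewrite /ctrl_op mulmx_suml; apply: eq_bigr => l _.
rewrite mulmx_sumr (bigD1 l) //= big1 => [|k kl];
  rewrite tensmx_mul pure_ket_mul ?eqxx ?tens_opM ?addr0 //.
by rewrite eq_sym (negbTE kl) tens0mx.
Qed.

Lemma ctrl_op1 (C : numClosedFieldType) d :
  ctrl_op (fun _ _ : 'I_d => 1%:M : 'M[C]_2) = 1%:M.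
Proof. by rewrite /ctrl_op tens_op1 -tensmx_suml sum_pure_ket tensmx11. Qed.

Lemma ctrl_op_unitary (C : numClosedFieldType) d (A : 'I_d -> 'I_d -> 'M[C]_2) :
  (forall l j, A l j \is unitarymx) -> ctrl_op A \is unitarymx.
Proof.
move=> uA; apply/unitarymxP.
have -> : (ctrl_op A)^t* = ctrl_op (fun l j => (A l j)^t*).
  rewrite /ctrl_op raddf_sum /= map_mx_sum; apply: eq_bigr => l _.
  by rewrite adjmx_tens pure_ket_adj tens_op_adj.
by rewrite ctrl_opM -ctrl_op1; apply: eq_ctrl_op => l j; exact/unitarymxP.
Qed.

Lemma prod_ctrl_op (C : numClosedFieldType) d (I : Type) (s : seq I)
    (A : I -> 'I_d -> 'I_d -> 'M[C]_2) :
  \prod_(g <- s) ctrl_op (A g) = ctrl_op (fun l j => \prod_(g <- s) A g l j).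
Proof.
elim: s => [|g s IH].
  rewrite big_nil -[1]/(1%:M) -ctrl_op1.
  by apply: eq_ctrl_op => l j; rewrite big_nil.
rewrite big_cons IH -[_ * _]/(_ *m _) ctrl_opM.
by apply: eq_ctrl_op => l j; rewrite big_cons.
Qed.

(** * The gates *)

Definition bit_flip (C : numClosedFieldType) : 'M[C]_2 :=
  \matrix_(a, b) (a == rev_ord b)%:R.

Lemma bit_flipM (C : numClosedFieldType) n (M : 'M[C]_(2, n)) a j :
  (bit_flip C *m M) a j = M (rev_ord a) j.
Proof.
rewrite mxE (bigD1 (rev_ord a)) //= mxE rev_ordK eqxx mul1r.
rewrite big1 ?addr0 // => b ba.
by rewrite mxE eq_sym (can2_eq rev_ordK rev_ordK) (negbTE ba) mul0r.
Qed.

Lemma bit_flip_unitary (C : numClosedFieldType) : bit_flip C \is unitarymx.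
Proof.
apply/unitarymxP/matrixP => a b; rewrite bit_flipM !mxE conjC_nat.
by rewrite rev_ordK eq_sym.
Qed.

Definition gate_factor (C : numClosedFieldType) d (Rot : 'M[C]_2)
    (g : 'I_d + 'I_d) (l j : 'I_d) : 'M[C]_2 :=
  match g with
  | inl i => if j == i then Rot else 1%:M
  | inr k => if (l == k) && (j == k) then bit_flip C else 1%:M
  end.

(** For the controlled NOT, the sum over x of |V x><x|, with V the product
    operator selected by l, is V itself because the |x><x| sum to the
    identity. *)
Lemma gate_opE (C : numClosedFieldType) d (Rot : 'M[C]_2) (g : 'I_d + 'I_d) :
  gate_op Rot g = ctrl_op (gate_factor Rot g).
Proof.
case: g => [i|k] /=.
  by rewrite /rot_gate -(sum_pure_ket C d) tensmx_suml.
apply: eq_bigr => l _.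
set A := gate_factor Rot (inr k) l.
transitivity (\sum_(x : bits d)
    pure_state (ket C l) *t ((tens_op A *m bits_ket C x) *m (bits_ket C x)^t*)).
  apply: eq_bigr => x _; rewrite -tensmx_mul -adjmx_tens; congr ((_ *t _) *m _).
  rewrite tens_op_vec; apply/matrixP => y z; rewrite /bits_ket !mxE.
  apply: eq_bigr => j _; rewrite /A /= [l == k]eq_sym.
  case: eqVneq => _ /=; last by rewrite mul1mx.
  rewrite ffunE; case: eqP => _; last by rewrite mul1mx.
  by rewrite bit_flipM !mxE (can2_eq rev_ordK rev_ordK).
rewrite -tensmx_sumr; congr (_ *t _).
under eq_bigr do rewrite -mulmxA -/(pure_state _).
rewrite -mulmx_sumr -sum_enum_bits.
under eq_bigr do rewrite bits_ketE enum_valK.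
by rewrite sum_pure_ket mulmx1.
Qed.

Lemma perm_gates d :
  perm_eq (map inr (enum 'I_d) ++ map inl (enum 'I_d)) (enum {: 'I_d + 'I_d}).
Proof.
have inlI : injective (@inl 'I_d 'I_d) by move=> ? ? [].
have inrI : injective (@inr 'I_d 'I_d) by move=> ? ? [].
apply: uniq_perm.
- rewrite cat_uniq (map_inj_uniq inlI) (map_inj_uniq inrI) enum_uniq andbT /=.
  by apply/hasPn => _ /mapP[i _ ->]; apply/mapP => -[].
- exact: enum_uniq.
- move=> [i|i]; rewrite mem_cat mem_enum.
  + by rewrite orbC map_f // mem_enum.
  + by rewrite map_f // mem_enum.
Qed.

(** A product over all qubits in which each factor concerns a single qubit: at
    qubit j only the factor of index j remains, which makes the order of the
    product irrelevant although the ring need not be commutative. *)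
Lemma prod_ord_if (R : pzRingType) d (P : pred 'I_d) (j : 'I_d) (M : R) :
  \prod_(k <- enum 'I_d) (if P k && (j == k) then M else 1) =
  if P j then M else 1.
Proof.
rewrite -big_mkcond /=.
case: ifP => Pj; last first.
  by rewrite big1 // => k /andP[Pk /eqP jk]; rewrite jk Pk in Pj.
rewrite -big_filter (eq_filter (a2 := pred1 j)) => [|k].
  by rewrite filter_pred1_uniq ?enum_uniq ?mem_enum // big_seq1.
by rewrite /= eq_sym; case: eqP => [->|]; rewrite ?Pj ?andbF.
Qed.

(** In the order chosen here the controlled NOT gates stand to the left of the
    rotations: they are applied after them. *)
Lemma prod_gates (C : numClosedFieldType) d (Rot : 'M[C]_2) :
  \prod_(g <- map inr (enum 'I_d) ++ map inl (enum 'I_d)) gate_op Rot g =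
  ctrl_op (fun l j => (if l == j then bit_flip C else 1%:M) *m Rot).
Proof.
under eq_bigr do rewrite gate_opE.
rewrite prod_ctrl_op; apply: eq_ctrl_op => l j.
rewrite big_cat 2!big_map -[_ *m _]/(_ * _).
congr (_ * _); first exact: (@prod_ord_if 'M[C]_2 d (fun k => l == k)).
exact: (@prod_ord_if 'M[C]_2 d xpredT).
Qed.

(** * Readout of the ancillas *)

Lemma ctrl_op_vec (C : numClosedFieldType) d (A : 'I_d -> 'I_d -> 'M[C]_2)
    (psi : 'cV[C]_d) (v : 'I_d -> 'cV[C]_2) :
  ctrl_op A *m (psi *t tens_vec v) =
  \sum_(l < d)
    (pure_state (ket C l) *m psi) *t tens_vec (fun j => A l j *m v j).
Proof.
rewrite /ctrl_op mulmx_suml; apply: eq_bigr => l _.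
by rewrite tensmx_mul tens_op_vec.
Qed.

Lemma pure_bits_ket_vec (C : numClosedFieldType) d (w : bits d)
    (v : 'I_d -> 'cV[C]_2) :
  pure_state (bits_ket C w) *m tens_vec v =
  (\prod_j v j (w j) 0) *: bits_ket C w.
Proof.
rewrite bits_ketE pure_ketE /ket; apply/matrixP => x y.
rewrite mxE (bigD1 (enum_rank w)) //= big1 => [|z zw]; last first.
  by rewrite !mxE (negbTE zw) andbF mul0r.
rewrite !mxE !eqxx [y]ord1 eqxx !andbT addr0 enum_rankK.
by case: eqP; rewrite ?(mul1r, mulr1, mul0r, mulr0).
Qed.

Lemma bits_measurement_complete (C : numClosedFieldType) m d :
  \sum_(w : bits d) ((1%:M : 'M[C]_m) *t pure_state (bits_ket C w))^t* *m
    ((1%:M : 'M[C]_m) *t pure_state (bits_ket C w)) = 1%:M.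
Proof.
rewrite -sum_enum_bits.
under eq_bigr do rewrite bits_ketE enum_valK adjmx_tens tensmx_mul pure_ket_adj
  pure_ket_mul eqxx trmx1 map_mx1 mulmx1.
by rewrite -tensmx_sumr sum_pure_ket tensmx11.
Qed.

Lemma tr_pure_bits_ket (C : numClosedFieldType) d (w : bits d) :
  \tr (pure_state (bits_ket C w)) = 1.
Proof.
rewrite bits_ketE pure_ketE /mxtrace (bigD1 (enum_rank w)) //= mxE eqxx.
rewrite big1 ?addr0 // => i iw.
by rewrite mxE (negbTE iw).
Qed.

(** If an outcome on the composite system leaves a product vector, the
    unnormalized post-measurement states have the same reduction to the first
    factor.  The probabilities, being their traces, then agree as well, and so
    do the normalized states; an outcome of probability zero is covered, since
    both sides are then scaled by the same inverse. *)
Lemma ancilla_readout (C : numClosedFieldType) (O : finType) m n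
    (M : measurement C O m) (MB : measurement C O (m * n)) (o : O)
    (psi : 'cV[C]_m) (v : 'cV[C]_(m * n)) (chi : 'cV[C]_n) :
  \tr (pure_state chi) = 1 -> MB o *m v = (M o *m psi) *t chi ->
  outcome_prob MB (pure_state v) o = outcome_prob M (pure_state psi) o /\
  ptrace2 (post_state MB (pure_state v) o) = post_state M (pure_state psi) o.
Proof.
move=> tr_chi MBv.
have reduced : ptrace2 (MB o *m pure_state v *m (MB o)^t*)
    = M o *m pure_state psi *m (M o)^t*.
  by rewrite -!pure_stateM MBv pure_state_tens ptrace2_tens tr_chi scale1r.
have prob :
    outcome_prob MB (pure_state v) o = outcome_prob M (pure_state psi) o.
  by rewrite !outcome_prob_tr -reduced mxtrace_ptrace2.
by split; rewrite // /post_state ptrace2Z reduced prob.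
Qed.

(** Projecting the ancillas on |w> turns the vector prepared for the qudit value
    l into its amplitude at w, a scalar that then acts as a diagonal operator
    on the qudit. *)
Lemma ctrl_op_readout (C : numClosedFieldType) d
    (A : 'I_d -> 'I_d -> 'M[C]_2) (psi : 'cV[C]_d) (v : 'I_d -> 'cV[C]_2)
    (w : bits d) :
  (1%:M *t pure_state (bits_ket C w)) *m (ctrl_op A *m (psi *t tens_vec v)) =
  ((\sum_(l < d) (\prod_(j < d) (A l j *m v j) (w j) 0) *:
     pure_state (ket C l)) *m psi) *t bits_ket C w.
Proof.
rewrite ctrl_op_vec mulmx_sumr mulmx_suml tensmx_suml; apply: eq_bigr => l _.
by rewrite tensmx_mul mul1mx pure_bits_ket_vec tensmxZr -scalemxAl tensmxZl.
Qed.

(** * The rotation and its amplitudes *)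

Definition rotation (R : realType) (a b : R) : 'M[R[i]]_2 :=
  \matrix_(x, y) (if x == y then a else if x == 0 then - b else b)%:C.

Lemma rotation_unitary (R : realType) (a b : R) :
  a ^+ 2 + b ^+ 2 = 1 -> rotation a b \is unitarymx.
Proof.
move=> ab; apply/unitarymxP/matrixP => x y.
have conjCR (z : R) : Num.conj (z%:C : R[i]) = z%:C.
  by apply/conj_Creal; rewrite complex_real.
rewrite !mxE.
under eq_bigr do rewrite !mxE conjCR -rmorphM.
rewrite -rmorph_sum -(rmorph_nat (real_complex R)); congr (_%:C).
rewrite 2!big_ord_recl big_ord0 addr0.
case: x => [[|[]]] // ?; case: y => [[|[]]] // ? /=; rewrite -?ab; ring.
Qed.

(** The probability that a rotated |0> is read as 0. *)
Definition zero_prob (R : realType) (delta : R) : R :=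
  expR (delta / 2) / (expR (delta / 2) + 1).

Definition delta_rotation (R : realType) (delta : R) : 'M[R[i]]_2 :=
  rotation (Num.sqrt (zero_prob delta))
    (Num.sqrt (zero_prob delta) * expR (- (delta / 4))).

Lemma zero_prob_gt0 (R : realType) (delta : R) : 0 < zero_prob delta.
Proof. by rewrite divr_gt0 ?addr_gt0 ?expR_gt0. Qed.

(** This is the normalization p + p e^(-delta/2) = 1. *)
Lemma delta_rotation_unitary (R : realType) (delta : R) :
  delta_rotation delta \is unitarymx.
Proof.
apply: rotation_unitary.
rewrite exprMn sqr_sqrtr ?ltW ?zero_prob_gt0 // expr2 -expRD.
have -> : - (delta / 4) + - (delta / 4) = - (delta / 2) by field.
have e0 : expR (delta / 2) + 1 != 0 by rewrite gt_eqF ?addr_gt0 ?expR_gt0.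
have e1 : expR (delta / 2) != 0 by rewrite gt_eqF ?expR_gt0.
by rewrite expRN /zero_prob; field; rewrite e0 e1.
Qed.

(** Flipping the bit exchanges the amplitudes of 0 and 1, so the flip e plays
    the part of the bit from which the distance is measured. *)
Lemma qubit_amplitude (R : realType) (delta : R) (e : bool) (x : 'I_2) :
  (((if e then bit_flip R[i] else 1%:M) *m delta_rotation delta) *m
    ket R[i] 0) x 0
  = (Num.sqrt (zero_prob delta) *
     expR (- (delta / 4) *
       `|(x : nat)%:R - ((if e then 1 else 0 : 'I_2) : nat)%:R|))%:C.
Proof.
rewrite -mulmxA.
case: e; rewrite ?mul1mx ?bit_flipM mxE 2!big_ord_recl big_ord0 !mxE;
  case: x => [[|[]]] // ? /=; rewrite ?mulr0 ?mulr1 ?addr0 ?modn_small //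
  ?subrr ?subr0 ?sub0r ?normrN ?normr0 ?normr1 ?mulr1 ?mulr0 ?expR0 ?mulr1 //.
Qed.

Lemma prod_amplitude (R : realType) (delta : R) d (l : 'I_d) (w : bits d) :
  \prod_(j < d) (Num.sqrt (zero_prob delta) *
    expR (- (delta / 4) * `|(w j : nat)%:R - (std_bits l j : nat)%:R|))
  = zero_prob delta `^ (d%:R / 2) *
    expR (- (delta / 4) * l1_dist R w (std_bits l)).
Proof.
rewrite big_split /= prodr_const card_ord -expR_sum -mulr_sumr; congr (_ * _).
rewrite mulrC powRrM powR12_sqrt ?ltW ?zero_prob_gt0 //.
by rewrite powR_mulrn ?sqrtr_ge0.
Qed.

(** The link between the circuit and M_delta: the l1 distance in the exponent is
    a sum over the qubits, so its exponential splits into the amplitudes of the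
    single qubits. *)
Lemma delta_opE (R : realType) (delta : R) d (w : bits d) :
  delta_op delta w =
  \sum_(l < d) (\prod_(j < d)
    (((if l == j then bit_flip R[i] else 1%:M) *m delta_rotation delta) *m
      ket R[i] 0) (w j) 0) *: pure_state (ket R[i] l).
Proof.
rewrite /delta_op scaler_sumr; apply: eq_bigr => l _.
rewrite scalerA -rmorphM -prod_amplitude rmorph_prod; congr (_ *: _).
by apply: eq_bigr => j _; rewrite qubit_amplitude ffunE [l == j]eq_sym.
Qed.

(** * The circuit *)

Theorem proposition7 (R : realType) (delta : R) (hdelta : 0 < delta) :
  exists2 Rot : 'M[R[i]]_2, Rot \is unitarymx &
  forall d : nat,
  exists (U : 'M[R[i]]_(d * #|bits d|))
         (MB : measurement R[i] (bits d) (d * #|bits d|)),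
  [/\ U \is unitarymx,
      comprised_of_gates Rot U,
      forall w : bits d, MB w = 1%:M *t pure_state (bits_ket R[i] w)
    & forall psi : 'cV[R[i]]_d, unit_vector psi ->
      let rho : 'M[R[i]]_d := pure_state psi in
      let sigma : 'M[R[i]]_#|bits d| :=
        pure_state (tens_vec (fun _ : 'I_d => ket R[i] 0)) in
      let rhoU : 'M[R[i]]_(d * #|bits d|) := U *m (rho *t sigma) *m U^t* in
      forall w : bits d,
        outcome_prob MB rhoU w
          = outcome_prob (delta_measurement delta d) rho w /\
        ptrace2 (post_state MB rhoU w)
          = post_state (delta_measurement delta d) rho w].
Proof.
exists (delta_rotation delta); first exact: delta_rotation_unitary.
move=> d.
exists (ctrl_op (fun l j =>
  (if l == j then bit_flip R[i] else 1%:M) *m delta_rotation delta)).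
exists (Measurement (@bits_measurement_complete R[i] d d)); split.
- apply: ctrl_op_unitary => l j.
  rewrite mul_unitarymx ?delta_rotation_unitary //; case: eqP => // _.
    exact: bit_flip_unitary.
  by apply/unitarymxP; rewrite trmx1 map_mx1 mulmx1.
- by exists (map inr (enum 'I_d) ++ map inl (enum 'I_d));
    rewrite ?perm_gates ?prod_gates.
- by [].
- move=> psi _ rho sigma rhoU w.
  rewrite {}/rhoU {}/rho {}/sigma -pure_state_tens -pure_stateM.
  apply: (ancilla_readout (tr_pure_bits_ket R[i] w)).
  by rewrite [LHS]ctrl_op_readout [delta_measurement _ _ _]delta_opE.
Qed.
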